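(* Let $T$ be a nonspecial tree of height $\omega_1$. Then $\diamondsuit_T$ implies $2^\omega\le|T_{\ge\omega}|$, where $T_{\geq\omega}$ is the set of nodes of $T$ of height at least $\omega$.
   Context: A tree is a partial order $(T,<_T)$ in which the set of predecessors of each node is well-ordered; every tree is assumed to have a root, denoted $\emptyset$. For $t\in T$, $t{\downarrow}=\{s\in T\mid s<_T t\}$, $\mathrm{ht}(t)$ is the order type of $t{\downarrow}$, and $T_\alpha$ is the set of nodes of height $\alpha$. The height of $T$ is the least $\alpha$ with $T_\alpha=\emptyset$. Levels are not assumed to be countable. An antichain is a set of pairwise incomparable nodes. A set $U\subseteq T$ is special if it is a union of at most countably many antichains; otherwise it is nonspecial. For $X\subseteq T$, a map $f:X\to T$ is regressive if $f(t)<_T t$ for all $t\in X\setminus\{\emptyset\}$. For $T$ of height $\omega_1$, $NS^T$ is the ideal of all $B\subseteq T$ for which there is a regressive $f:B\to T$ such that $f^{-1}(\{t\})$ is special for every $t\in T$. For a nonspecial tree $T$ of height $\omega_1$, $\diamondsuit_T$ asserts that there is a sequence $(D_t\mid t\in T)$ with $D_t\subseteq t{\downarrow}$ for all $t\in T$ such that for every $X\subseteq T$, $\{t\in T\mid X\cap t{\downarrow}=D_t\}\notin NS^T$. *)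

(* Defs.v *)
From mathcomp Require Import all_boot all_order.
From mathcomp Require Import boolp wochoice classical_sets functions cardinality.

Set Implicit Arguments.
Unset Strict Implicit.
Unset Printing Implicit Defensive.
Import Order.TTheory.

Local Open Scope order_scope.
Local Open Scope classical_set_scope.

(* An ordinal is represented by any well-ordered type of that order type; two
   representatives denote the same ordinal when they are order-isomorphic
   ([ord_eq]), but need not be equal. *)
Record ordnum := Ordnum {
  ord_sort :> Type;
  ord_rel : rel ord_sort;
  ord_wo : well_order ord_rel }.

Definition ord_eq (a b : ordnum) : Prop :=
  exists f : a -> b, bijective f /\ {mono f : x y / ord_rel x y}.

(* [a] is isomorphic to the proper initial segment of [b] below some [z]. *)
Definition ord_lt (a b : ordnum) : Prop :=
  exists (z : b) (f : a -> b), {mono f : x y / ord_rel x y} /\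
    range f = [set y | ord_rel y z /\ y <> z].

Definition ord_le (a b : ordnum) : Prop := ord_lt a b \/ ord_eq a b.

Lemma well_order_leq : well_order leq.
Proof.
apply: antisymmetric_well_order; first exact: anti_leq.
move=> A exA; case: (ex_minnP exA) => m Am minm.
by exists m; split.
Qed.

Definition omega : ordnum := Ordnum well_order_leq.

(* The first uncountable ordinal. *)
Definition is_omega1 (a : ordnum) : Prop :=
  ~ countable [set: a] /\ forall b : ordnum, ord_lt b a -> countable [set: b].

Definition below d (T : porderType d) (t : T) : set T := [set s | s < t].

(* The order of [T] restricted to the subtype of elements of [A]. *)
Definition sub_le d (T : porderType d) (A : set T) : rel A :=
  fun x y => sval x <= sval y.

(* The root is [\bot]. *)
Record tree d := Tree {
  tree_sort :> bPOrderType d;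
  tree_wo : forall t : tree_sort, well_order (@sub_le d tree_sort (below t)) }.

Arguments tree_wo {d} T t : rename.

Section Trees.
Context {d : Order.disp_t} {T : tree d}.
Implicit Types (t : T) (A B U X : set T) (a : ordnum).

Definition ht t : ordnum := Ordnum (tree_wo T t).

Definition level a : set T := [set t | ord_eq (ht t) a].

Definition level_ge a : set T := [set t | ord_le a (ht t)].

Definition antichain A : Prop :=
  forall s t, A s -> A t -> s <> t -> s >< t.

Definition special U : Prop :=
  exists F : set (set T),
    [/\ countable F, forall A, F A -> antichain A & U = \bigcup_(A in F) A].

(* A map [X -> T] is given by a total map of which only the values on [X]
   matter. *)
Definition regressive X (f : T -> T) : Prop :=
  forall t, X t -> t <> \bot -> f t < t.

Definition NS : set (set T) :=
  [set B | exists f : T -> T, regressive B f /\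
    forall t, special (B `&` f @^-1` [set t])].

End Trees.

Arguments level {d} T a.
Arguments level_ge {d} T a.
Arguments NS {d} T.

Definition height_is d (T : tree d) (a : ordnum) : Prop :=
  level T a = set0 /\ forall b : ordnum, level T b = set0 -> ord_le a b.

Definition height_omega1 d (T : tree d) : Prop :=
  exists a : ordnum, is_omega1 a /\ height_is T a.

Definition nonspecial_tree d (T : tree d) : Prop := ~ special [set: T].

Definition diamond d (T : tree d) : Prop :=
  exists D : T -> set T,
    (forall t, D t `<=` below t) /\
    forall X : set T, ~ NS T [set t | X `&` below t = D t].

(* Main.v *)
(** For a real [x], let [X_x] be the set of nodes whose height is some finite
    [n] with [x n = true]. The nodes with finitely many predecessors form
    countably many antichains, hence a set in [NS]; so the diamond sequence
    guesses [X_x] at some node [t] of infinite height. Such a [t] has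
    predecessors of every finite height, so [D t] determines [x]. *)
Require Import Defs.
From mathcomp Require Import all_boot all_order.
From mathcomp Require Import finmap.
From mathcomp Require Import boolp classical_sets functions cardinality.

Import Order.TTheory.
Local Open Scope classical_set_scope.
Local Open Scope card_scope.

Lemma subset_special d (T : tree d) (A B : set T) :
  A `<=` B -> special B -> special A.
Proof.
move=> AB [F [cF aF BF]]; exists [set A `&` C | C in F]; split.
- exact: card_le_trans (card_image_le _ _) cF.
- by move=> _ [C FC <-] s t [_ Cs] [_ Ct]; exact: aF FC _ _ Cs Ct.
- apply/seteqP; split=> [t At|t [_ [C _ <-]] []//].
  have: B t by exact: AB.
  by rewrite BF => -[C FC Ct]; exists (A `&` C) => //; exists C.
Qed.

(** The constant map to the root is a regressive witness: each of its fibres on [A] is a subset of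
    [A], hence special. *)
Lemma special_NS d (T : tree d) (A : set T) : special A -> NS T A.
Proof.
move=> spA; exists (fun=> \bot%O); split=> [t _ /eqP|t].
  by rewrite lt0x.
by apply: subset_special spA => s [].
Qed.

Section FiniteHeight.
Local Open Scope order_scope.
Context {d : Order.disp_t} {T : tree d}.
Implicit Types (s t u : T) (A B : set T).

(* The height of [t] when it is finite, and the junk value [0] otherwise. *)
Definition fin_ht t : nat := #|` fset_set (below t)|%fset.

Lemma fin_ht_lt s t : finite_set (below t) -> s < t -> (fin_ht s < fin_ht t)%N.
Proof.
move=> fint st.
have sub : below s `<=` below t by move=> u us; exact: lt_trans us st.
have fins : finite_set (below s) := sub_finite_set sub fint.
apply: fproper_ltn_card; rewrite fproperE; apply/andP; split.
  by apply/fsubsetP => u; rewrite !in_fset_set// !inE; exact: sub.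
apply/negP => /fsubsetP/(_ s).
rewrite !in_fset_set// => /(_ (mem_set st)).
by rewrite inE /below /= ltxx.
Qed.

(** Since [fin_ht] strictly increases along the order at these nodes, each of its fibres among them
    is an antichain, and there is one fibre for each natural number. *)
Lemma special_finite_height : special [set t : T | finite_set (below t)].
Proof.
exists (range (fun n (t : T) => finite_set (below t) /\ fin_ht t = n)); split.
- exact: card_le_trans (card_image_le _ _) (countableP _).
- move=> _ [n _ <-] s t [fins hs] [fint ht] st.
  apply/negP => /orP[]; rewrite le_eqVlt => /predU1P[e|lt]; try exact: st.
  + by move: (fin_ht_lt s t fint lt); rewrite hs ht ltnn.
  + by move: (fin_ht_lt t s fins lt); rewrite hs ht ltnn.
- apply/seteqP; split=> [t fint|t [_ [n _ <-]] []//].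
  by exists (fun u => finite_set (below u) /\ fin_ht u = fin_ht t) => //;
    exists (fin_ht t).
Qed.

Lemma below_min t B : B `<=` below t -> B !=set0 ->
  exists2 u, B u & forall v, B v -> u <= v.
Proof.
move=> Bt [s Bs].
have mem v : B v -> v \in below t by move=> /Bt; rewrite inE.
have ne : wochoice.nonempty
    ([pred x | `[< B (sval x) >]] : {pred set_type (below t)}).
  by exists (exist _ s (mem s Bs)); apply/asboolP.
have [[u ut] [[/asboolP/= Bu minu] _]] := tree_wo T t _ ne.
exists u => // v Bv.
exact: minu (exist _ v (mem v Bv)) (asboolT Bv).
Qed.

Lemma below_total s s' t : s < t -> s' < t -> (s <= s') || (s' <= s).
Proof.
move=> st s't; have [||u [->|->] minu] := @below_min t [set s; s'].
- by move=> _ [->|->].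
- by exists s; left.
- by rewrite minu//; right.
- by rewrite orbC minu//; left.
Qed.

(** The node [u] is the least element of the complement of [A] in [below t]. *)
Lemma initial_segment_below t A : A `<=` below t ->
  (forall s u, A s -> u < s -> A u) -> A <> below t ->
  exists2 u, u < t & below u = A.
Proof.
move=> At downA neA.
have [||u [ut nAu] minu] := @below_min t (below t `\` A).
- by move=> u [].
- apply: contrapT => /set0P/negP; rewrite negbK => /eqP.
  by rewrite setD_eq0 => tA; apply/neA/seteqP.
exists u => //; apply/seteqP; split=> [s su|s As].
  apply: contrapT => nAs.
  have := minu s (conj (lt_trans su ut) nAs).
  by rewrite (lt_geF su).
have /orP[] := below_total u s t ut (At _ As).
  rewrite le_eqVlt => /predU1P[us|us]; first by rewrite us in nAu.
  by have := nAu (downA _ _ As us).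
by rewrite le_eqVlt => /predU1P[us|//]; rewrite us in As.
Qed.

(** By induction on [n]: the successor of [s] towards [t] is the node whose predecessors are [s] and
    those of [s]. It exists because this initial segment is finite, hence proper in the infinite
    [below t]. *)
Lemma exists_fin_ht t n : infinite_set (below t) ->
  exists s, [/\ s < t, finite_set (below s) & fin_ht s = n].
Proof.
move=> inft; elim: n => [|n [s [st fins hs]]].
  have [//|//||u ut u0] := @initial_segment_below t set0.
    by move=> e; apply: inft; rewrite -e.
  by exists u; split=> //; rewrite /fin_ht u0 ?fset_set0.
have finS : finite_set (s |` below s) by rewrite finite_setU.
have [|||u ut uE] := @initial_segment_below t (s |` below s).
- by move=> v [->//|vs]; exact: lt_trans vs st.
- by move=> v w [->|vs] wv; right => //; exact: lt_trans wv vs.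
- by move=> e; apply: inft; rewrite -e.
exists u; split; rewrite /fin_ht ?uE // fset_setU1// cardfsU1 -/(fin_ht s) hs.
by rewrite in_fset_set// memNset// /below /= ltxx.
Qed.

(** The predecessors of [t] of finite height, listed by height as [f], form an initial segment of
    type [omega]. *)
Lemma infinite_below_level_ge t : infinite_set (below t) -> level_ge T omega t.
Proof.
move=> inft.
have [f fP] := choice (fun n => exists_fin_ht t n inft).
have ft n : f n \in below t by rewrite inE; case: (fP n).
have f_le m n : (f m <= f n) = (m <= n)%N.
  have [mt finm hm] := fP m; have [nt finn hn] := fP n.
  apply/idP/idP => [|mn].
    rewrite le_eqVlt => /predU1P[e|/(fin_ht_lt _ _ finn)].
      by rewrite -hm -hn e.
    by rewrite hm hn => /ltnW.
  have /orP[//|] := below_total _ _ _ mt nt.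
  rewrite le_eqVlt => /predU1P[->//|/(fin_ht_lt _ _ finm)].
  by rewrite hm hn ltnNge mn.
have f_down s u : range f s -> u < s -> range f u.
  move=> [n _ <-] un; have [nt finn _] := fP n.
  have sub : below u `<=` below (f n) by move=> v vu; exact: lt_trans vu un.
  have finu : finite_set (below u) := sub_finite_set sub finn.
  (* Both [u] and [f (fin_ht u)] lie below [t], so they are comparable; having the same finite
     height, they are equal. *)
  have [mt finm hm] := fP (fin_ht u).
  exists (fin_ht u) => //.
  have /orP[] := below_total _ _ _ mt (lt_trans un nt).
    by rewrite le_eqVlt => /predU1P[//|/(fin_ht_lt _ _ finu)]; rewrite hm ltnn.
  by rewrite le_eqVlt => /predU1P[//|/(fin_ht_lt _ _ finm)]; rewrite hm ltnn.
pose g n : set_type (below t) := exist _ (f n) (ft n).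
(* If [f] exhausts [below t], the height of [t] is [omega]; otherwise the range of [f] is [below z]
   for some [z] below [t], and the height exceeds [omega]. *)
have [fE|fNE] := pselect (range f = below t).
  right; exists g; split=> //.
  have gsurj (y : set_type (below t)) : exists n, g n = y.
    case: y => y yt; have : range f y by rewrite fE; exact: set_mem yt.
    by move=> [n _ e]; exists n; exact: val_inj.
  have [h hK] := choice gsurj.
  exists h => // n; apply/eqP; rewrite eqn_leq -!f_le.
  by have /(congr1 sval)/= -> := hK (g n); rewrite lexx.
left; have [||//|z zt zE] := @initial_segment_below t (range f).
- by move=> _ [n _ <-]; exact: set_mem (ft n).
- exact: f_down.
have zt' : z \in below t by rewrite inE.
exists (exist _ z zt'), g; split=> //.
apply/seteqP; split=> [_ [n _ <-]|[y yt] [/= yz /eqP ny]].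
  have fz : f n < z by change (below z (f n)); rewrite zE; exists n.
  split; first exact: ltW.
  by move=> /(congr1 sval)/= e; rewrite e ltxx in fz.
have : below z y by rewrite /below /= lt_neqAle; apply/andP; split.
by rewrite zE => -[n _ e]; exists n => //; exact: val_inj.
Qed.

End FiniteHeight.

Theorem proposition3p22 (d : Order.disp_t) (T : tree d)
    (T_nonspecial : nonspecial_tree T) (T_height : height_omega1 T) :
  diamond T -> [set: nat -> bool] #<= level_ge T omega.
Proof.
move=> [D [_ guess]].
pose X (x : nat -> bool) : set T :=
  [set s | finite_set (below s) /\ x (fin_ht s)].
have ex x : exists t, infinite_set (below t) /\ X x `&` below t = D t.
  apply: contrapT => /forallNP nt; apply: (guess (X x)).
  apply: special_NS; apply: subset_special special_finite_height => t tD.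
  by apply: contrapT => inft; exact: (nt t).
have [g gP] := choice ex.
have g_inj : injective g.
  move=> x y gxy; apply/funext => n.
  have [infx Dx] := gP x; have [_ Dy] := gP y.
  have [s [sx fins sn]] := exists_fin_ht (g x) n infx.
  have XE : X x `&` below (g x) = X y `&` below (g x) by rewrite Dx gxy Dy.
  (* The node [s] lies below [g x] and has finite height [n], so its membership in [X z] reads off
     the bit [z n]. *)
  have memX z : (X z `&` below (g x)) s <-> z n.
    by split=> [[[_]]|zn]; rewrite ?sn//; split=> //; split=> //; rewrite sn.
  by apply/idP/idP => /memX; rewrite (XE, esym XE) => /memX.
apply: card_le_trans (_ : range g #<= _).
  by have /card_eqPle[] := inj_card_eq (A := setT) (in2W g_inj).
apply: subset_card_le => _ [x _ <-].
by apply: infinite_below_level_ge; case: (gP x).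
Qed.
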